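(* Let $\mathcal{M}=\{M^x:x\in\mathcal{I}\}$ be a standard log-convex weight matrix and let $\omega_{\mathcal{M}}=\{\omega_{M^x}:x\in\mathcal{I}\}$ be the matrix of associated weight functions. (I) The following conditions are equivalent: (i) $\forall C>0\ \forall x\in\mathcal{I}\ \exists D>0\ \exists y\in\mathcal{I}\ \forall j\in\mathbb{N}:\ C^jM^x_j\le D\,M^y_j$. (ii) $\forall x\in\mathcal{I}\ \exists D>0\ \exists y\in\mathcal{I}\ \forall j\in\mathbb{N}:\ 2^jM^x_j\le D\,M^y_j$. (iii) $\forall x\in\mathcal{I}\ \exists y\in\mathcal{I}\ \exists D>0\ \forall t\ge0:\ \omega_{M^y}(2t)\le\omega_{M^x}(t)+D$. (iv) $\forall C>0\ \forall x\in\mathcal{I}\ \exists y\in\mathcal{I}\ \exists D>0\ \forall t\ge0:\ \omega_{M^y}(Ct)\le\omega_{M^x}(t)+D$. (II) The following conditions are equivalent: (i) $\forall C>0\ \forall x\in\mathcal{I}\ \exists D>0\ \exists y\in\mathcal{I}\ \forall j\in\mathbb{N}:\ C^jM^y_j\le D\,M^x_j$. (ii) $\forall x\in\mathcal{I}\ \exists D>0\ \exists y\in\mathcal{I}\ \forall j\in\mathbb{N}:\ 2^jM^y_j\le D\,M^x_j$. (iii) $\forall x\in\mathcal{I}\ \exists y\in\mathcal{I}\ \exists D>0\ \forall t\ge0:\ \omega_{M^x}(2t)\le\omega_{M^y}(t)+D$. (iv) $\forall C>0\ \forall x\in\mathcal{I}\ \exists y\in\mathcal{I}\ \exists D>0\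 \forall t\ge0:\ \omega_{M^x}(Ct)\le\omega_{M^y}(t)+D$.
   Context: $\mathbb{N}=\{0,1,2,\dots\}$, $\mathcal{I}=\mathbb{R}_{>0}$. A sequence $M=(M_j)_{j\in\mathbb{N}}$ of positive reals is normalized if $1=M_0\le M_1$, and log-convex if $M_j^2\le M_{j-1}M_{j+1}$ for all $j\ge1$. $\mathcal{LC}$ is the set of normalized, log-convex $M$ with $\lim_j(M_j)^{1/j}=+\infty$. A weight matrix is a family $\mathcal{M}=\{M^x:x\in\mathcal{I}\}$ of normalized nondecreasing sequences with $M^x_j\le M^y_j$ for all $j$ whenever $x\le y$; it is standard log-convex if all $M^x\in\mathcal{LC}$. The associated function of $M\in\mathcal{LC}$ is $\omega_M(t)=\sup_{j\in\mathbb{N}}\log(t^j/M_j)$ for $t>0$, $\omega_M(0)=0$. (Conditions (I)(i) and (II)(i) are denoted $(\mathcal{M}_{\{\mathrm{L}\}})$ and $(\mathcal{M}_{(\mathrm{L})})$.) *)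

(* Defs.v *)
From mathcomp Require Import all_boot all_order all_algebra.
From mathcomp Require Import all_classical all_reals all_analysis.

Set Implicit Arguments.
Unset Strict Implicit.
Unset Printing Implicit Defensive.

Import Order.TTheory GRing.Theory Num.Theory.
Import numFieldNormedType.Exports.

Local Open Scope classical_set_scope.
Local Open Scope ring_scope.

Section WeightSequences.
Context {R : realType}.
Implicit Types M : nat -> R.

Definition positive_seq M := forall j, 0 < M j.

Definition normalized M := M 0%N = 1 /\ 1 <= M 1%N.

Definition log_convex M := forall j, M j.+1 ^+ 2 <= M j * M j.+2.

(* The value at j = 0 of the sequence of roots is irrelevant to the limit. *)
Definition LC M :=
  [/\ positive_seq M, normalized M, log_convex M &
      (M j `^ j%:R^-1) @[j --> \oo] --> +oo].

(* Extended-real valued, so that the supremum is meaningful for any positive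
   sequence; it is finite when M is in LC. *)
Definition associated_function M (t : R) : \bar R :=
  if t == 0 then 0%:E
  else ereal_sup [set (ln (t ^+ j / M j))%:E | j in [set: nat]].

(* The index set of all positive reals is the type {posnum R}. *)
Definition weight_matrix (M : {posnum R} -> nat -> R) :=
  (forall x, [/\ positive_seq (M x), normalized (M x) &
                 nondecreasing_seq (M x)]) /\
  (forall x y : {posnum R}, x%:num <= y%:num -> forall j, M x j <= M y j).

Definition standard_log_convex (M : {posnum R} -> nat -> R) :=
  weight_matrix M /\ forall x, LC (M x).

End WeightSequences.

Notation "'ω_ M" := (associated_function M)
  (at level 8, M at level 2, format "''ω_' M").

(* Main.v *)
(** Two facts suffice. For positive sequences A, B with A log-convex, the bound
    C^j A_j <= D B_j for all j amounts to w_B(C t) <= w_A(t) + D' for all t: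
    one direction is termwise comparison of the suprema, the other evaluates the
    bound at t = A_{j+1} / A_j, where log-convexity makes j the maximizing index
    of w_A(t). And the factor 2 improves to any C by iterating, since
    C <= 2^n for some n. *)

Require Import Defs.
From mathcomp Require Import all_boot all_order all_algebra.
From mathcomp Require Import all_classical all_reals all_analysis.
From mathcomp Require Import ring.

Import Order.TTheory GRing.Theory Num.Theory.
Import numFieldNormedType.Exports.

Local Open Scope ring_scope.

Set Implicit Arguments.
Unset Strict Implicit.
Unset Printing Implicit Defensive.

Section Domination.
Context {R : realType}.
Implicit Types (A B E : nat -> R) (C t : R).

Definition dominated C A B :=
  exists2 D : R, 0 < D & forall j, C ^+ j * A j <= D * B j.

Lemma dominated_trans C C' A B E : 0 <= C' ->
  dominated C A B -> dominated C' B E -> dominated (C * C') A E.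
Proof.
move=> C'0 [D D0 AB] [D' D'0 BE]; exists (D * D'); first exact: mulr_gt0.
move=> j; rewrite exprMn mulrAC mulrC.
apply: (le_trans (ler_wpM2l (exprn_ge0 j C'0) (AB j))).
by rewrite mulrCA -mulrA ler_wpM2l // ltW.
Qed.

Lemma dominated_le C C' A B : positive_seq A -> 0 <= C <= C' ->
  dominated C' A B -> dominated C A B.
Proof.
move=> A0 /andP[C0 CC'] [D D0 AB]; exists D => // j.
by apply: le_trans (AB j); rewrite ler_pM2r // lerXn2r ?nnegrE // (le_trans C0).
Qed.

(** Log-convexity makes the ratios [r i] nondecreasing. With [f i] the term of index [i] at the
    point [r j], consecutive terms differ by the factor [r j / r i], which is at least 1 for
    [i <= j] and at most 1 for [i >= j], so [f] peaks at [j]. *)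
Lemma log_convex_ratio_max A j k : positive_seq A -> log_convex A ->
  (A j.+1 / A j) ^+ k / A k <= (A j.+1 / A j) ^+ j / A j.
Proof.
move=> A0 cvx; pose r i := A i.+1 / A i.
have r0 i : 0 < r i by rewrite divr_gt0.
have r_nd : {homo r : m n / (m <= n)%N >-> m <= n}.
  apply: homo_leq => [//|? ? ?|i]; first exact: le_trans.
  by rewrite ler_pdivrMr // mulrAC ler_pdivlMr // -expr2 mulrC.
rewrite -/(r j); pose f i := r j ^+ i / A i; rewrite -/(f k) -/(f j).
have fS i : f i.+1 = f i * (r j / r i).
  rewrite /f exprS (_ : r i = A i.+1 / A i) //; move: (r j) => c; field.
  by rewrite !gt_eqF.
have f0 i : 0 < f i by rewrite divr_gt0 // exprn_gt0.
(* Induction on the distance [n] from [i] up to the peak [j]. *)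
have below n : forall i, (i + n)%N = j -> f i <= f j.
  elim: n => [|n IHn] i ij; first by rewrite -[in f j]ij addn0.
  apply: le_trans (IHn i.+1 _); last by rewrite addSnnS.
  by rewrite fS ler_peMr ?(ltW (f0 _)) // ler_pdivlMr // mul1r r_nd // -ij leq_addr.
have [kj|/ltnW jk] := leqP k j; first exact: below (subnKC kj).
rewrite -(subnKC jk); elim: (k - j)%N => [|n IHn]; first by rewrite addn0.
rewrite addnS fS; apply: le_trans IHn.
by rewrite ler_piMr ?(ltW (f0 _)) // ler_pdivrMr // mul1r r_nd // leq_addr.
Qed.

(** The powers of [t] cancel, so comparing the [j]-th terms of the two suprema at any single [t > 0]
    already gives the bound on the sequences. *)
Lemma scaled_term_le (a b C D t : R) j : 0 < t -> 0 < a -> 0 < b ->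
  ((C * t) ^+ j / b <= t ^+ j / a * D) = (C ^+ j * a <= D * b).
Proof.
move=> t0 a0 b0; rewrite ler_pdivrMr // exprMn.
rewrite -[RHS](ler_pM2r (_ : 0 < t ^+ j / a)) ?divr_gt0 ?exprn_gt0 //.
congr (_ <= _); field; rewrite gt_eqF //.
Qed.

Lemma dominatedP C A B : 0 < C -> positive_seq A -> positive_seq B ->
  log_convex A ->
  dominated C A B <->
  exists2 D : R, 0 < D & forall t, 0 <= t ->
    ('ω_B (C * t)%R <= 'ω_A t + D%:E)%E.
Proof.
move=> C0 A0 B0 cvx; split=> [[D D0 AB]|[D D0 AB]].
  (* [ln D] is the natural constant but may fail to be positive. *)
  exists (Num.max (ln D) 1); first by rewrite lt_max ltr01 orbT.
  move=> t; rewrite le_eqVlt => /predU1P[<-|t0]; rewrite /associated_function.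
    by rewrite mulr0 eqxx add0e lee_fin le_max ler01 orbT.
  rewrite !gt_eqF ?mulr_gt0 //; apply: ge_ereal_sup => _ [j _ <-].
  apply: (@le_trans _ _ ((ln (t ^+ j / A j))%:E + (ln D)%:E)%E); last first.
    by apply: leeD; [apply: ereal_sup_ubound; exists j|rewrite lee_fin le_max lexx].
  have tA : 0 < t ^+ j / A j by rewrite divr_gt0 // exprn_gt0.
  have tB : 0 < (C * t) ^+ j / B j by rewrite divr_gt0 // exprn_gt0 // mulr_gt0.
  rewrite -EFinD lee_fin -lnM ?posrE // ler_ln ?posrE //; last exact: mulr_gt0.
  by rewrite scaled_term_le.
exists (expR D); first exact: expR_gt0.
move=> j.
set t := A j.+1 / A j; have t0 : 0 < t by rewrite divr_gt0.
have tj : 0 < t ^+ j by rewrite exprn_gt0.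
have tB : 0 < (C * t) ^+ j / B j by rewrite divr_gt0 // exprn_gt0 // mulr_gt0.
(* At this [t] the supremum for [A] is attained at [j]; for [B] it is only bounded below by its
   [j]-th term. *)
have wA : ('ω_A t <= (ln (t ^+ j / A j))%:E)%E.
  rewrite /associated_function gt_eqF //; apply: ge_ereal_sup => _ [k _ <-].
  rewrite lee_fin ler_ln ?posrE ?divr_gt0 ?exprn_gt0 //.
  exact: log_convex_ratio_max.
have wB : ((ln ((C * t) ^+ j / B j))%:E <= 'ω_B (C * t))%E.
  rewrite /associated_function (gt_eqF (mulr_gt0 C0 t0)).
  by apply: ereal_sup_ubound; exists j.
have := le_trans wB (le_trans (AB _ (ltW t0)) (leeD wA (lexx D%:E))).
(* Writing [D] as [ln (expR D)] turns the right-hand side into the logarithm of a product. *)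
rewrite -EFinD lee_fin -(expRK D) -lnM ?posrE ?(divr_gt0 tj) ?expR_gt0 //.
rewrite ler_ln ?posrE //; last by rewrite mulr_gt0 ?divr_gt0 ?expR_gt0.
by rewrite scaled_term_le // expRK.
Qed.

End Domination.

(** Stated for an abstract relation so that it serves both parts, where domination runs in opposite
    directions along the indices. *)
Lemma factor2_to_any (R : realType) (I : Type) (P : R -> I -> I -> Prop) :
  (forall a b x y z, 0 <= a -> 0 <= b -> P a x y -> P b y z -> P (a * b) x z) ->
  (forall a b x y, 0 <= a <= b -> P b x y -> P a x y) ->
  (forall x, exists y, P 2 x y) ->
  forall C, 0 < C -> forall x, exists y, P C x y.
Proof.
move=> Ptrans Ple P2 C C0 x.
(* The exponent starts at 1 because [P 1 x x] is not assumed. *)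
have P2n n : exists y, P (2 ^+ n.+1) x y.
  elim: n => [|n [y xy]]; first by rewrite expr1.
  have [z yz] := P2 y; exists z; rewrite exprSr.
  by apply: Ptrans xy yz => //; rewrite exprn_ge0.
have [y xy] := P2n (Num.bound C); exists y; apply: Ple xy.
rewrite ltW //= (le_trans (ltW (archi_boundP (ltW C0)))) //.
by rewrite -natrX ler_nat ltnW // ltnW // ltn_expl.
Qed.

Theorem lemma3p1 (R : realType) (M : {posnum R} -> nat -> R)
    (hM : standard_log_convex M) :
  [<-> forall C : R, 0 < C -> forall x : {posnum R},
         exists2 D : R, 0 < D & exists y : {posnum R},
           forall j : nat, C ^+ j * M x j <= D * M y j;
       forall x : {posnum R},
         exists2 D : R, 0 < D & exists y : {posnum R},
           forall j : nat, 2 ^+ j * M x j <= D * M y j;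
       forall x : {posnum R}, exists y : {posnum R},
         exists2 D : R, 0 < D & forall t : R, 0 <= t ->
           ('ω_(M y) (2 * t)%R <= 'ω_(M x) t + D%:E)%E;
       forall C : R, 0 < C -> forall x : {posnum R}, exists y : {posnum R},
         exists2 D : R, 0 < D & forall t : R, 0 <= t ->
           ('ω_(M y) (C * t)%R <= 'ω_(M x) t + D%:E)%E]
  /\
  [<-> forall C : R, 0 < C -> forall x : {posnum R},
         exists2 D : R, 0 < D & exists y : {posnum R},
           forall j : nat, C ^+ j * M y j <= D * M x j;
       forall x : {posnum R},
         exists2 D : R, 0 < D & exists y : {posnum R},
           forall j : nat, 2 ^+ j * M y j <= D * M x j;
       forall x : {posnum R}, exists y : {posnum R},
         exists2 D : R, 0 < D & forall t : R, 0 <= t ->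
           ('ω_(M x) (2 * t)%R <= 'ω_(M y) t + D%:E)%E;
       forall C : R, 0 < C -> forall x : {posnum R}, exists y : {posnum R},
         exists2 D : R, 0 < D & forall t : R, 0 <= t ->
           ('ω_(M x) (C * t)%R <= 'ω_(M y) t + D%:E)%E].
Proof.
have [[M0 _] LCM] := hM.
have Mpos x : positive_seq (M x) by case: (M0 x).
have Mcvx x : log_convex (M x) by case: (LCM x).
(* The conditions on sequences choose [D] before [y], those on associated functions [y] before
   [D]. *)
have ex_comm (P : R -> {posnum R} -> Prop) :
    (exists2 D, 0 < D & exists y, P D y) <->
    (exists y, exists2 D, 0 < D & P D y).
  by split=> [[D D0 [y]]|[y [D D0]]]; [exists y; exists D|exists D => //; exists y].
have domP C x y (C0 : 0 < C) := dominatedP C0 (Mpos x) (Mpos y) (Mcvx x).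
split.
- have any2 : (forall x, exists y, dominated 2 (M x) (M y)) ->
      forall C, 0 < C -> forall x, exists y, dominated C (M x) (M y).
    apply: factor2_to_any => [a b x y z a0 b0 xy yz|a b x y]; last first.
      exact: dominated_le.
    exact: dominated_trans xy yz.
  tfae.
  + by move=> h x; apply: h.
  + move=> h x; have /ex_comm[y xy] := h x.
    by exists y; apply/(domP _ _ _ _).1.
  (* The factor is enlarged on the side of the sequences, then carried back to the associated
     functions. *)
  + move=> h C C0 x; have [|y xy] := any2 _ C C0 x.
      by move=> x'; have [y xy] := h x'; exists y; apply/(domP _ _ _ _).2.
    by exists y; apply/(domP _ _ _ _).1.
  + move=> h C C0 x; apply/ex_comm; have [y xy] := h C C0 x.
    by exists y; apply/(domP _ _ _ _).2.
- have any2 : (forall x, exists y, dominated 2 (M y) (M x)) ->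
      forall C, 0 < C -> forall x, exists y, dominated C (M y) (M x).
    apply: factor2_to_any => [a b x y z a0 b0 xy yz|a b x y]; last first.
      exact: dominated_le.
    (* Here the chain runs from [M z] through [M y] to [M x], so the factors come in the order
       [b * a]. *)
    by rewrite mulrC; exact: dominated_trans yz xy.
  tfae.
  + by move=> h x; apply: h.
  + move=> h x; have /ex_comm[y xy] := h x.
    by exists y; apply/(domP _ _ _ _).1.
  + move=> h C C0 x; have [|y xy] := any2 _ C C0 x.
      by move=> x'; have [y xy] := h x'; exists y; apply/(domP _ _ _ _).2.
    by exists y; apply/(domP _ _ _ _).1.
  + move=> h C C0 x; apply/ex_comm; have [y xy] := h C C0 x.
    by exists y; apply/(domP _ _ _ _).2.
Qed.
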